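(* Let $d=3$. There exists a Borel function $V\le 0$ on $\mathbb{R}^3$ such that (a) $V\in\mathcal K_3$ and (b) $\|S(V,t)\|_\infty=\infty$ for every $t>0$.
   Context: $g(t,x,y)=(4\pi t)^{-d/2}e^{-|y-x|^2/(4t)}$. For Borel $V$, $S(V,t,x,y)=\int_0^t\int_{\mathbb{R}^d}\frac{g(s,x,z)g(t-s,z,y)}{g(t,x,y)}|V(z)|\,dz\,ds$ and $\|S(V,t)\|_\infty=\sup_{x,y}S(V,t,x,y)$. $V\in\mathcal K_d$ (Kato class) means $\lim_{t\to0^+}\sup_{x\in\mathbb{R}^d}\int_0^t\int_{\mathbb{R}^d}g(s,x,z)|V(z)|\,dz\,ds=0$. *)

(* Defs.v *)
From HB Require Import structures.
From mathcomp Require Import all_boot all_order all_algebra.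
From mathcomp Require Import all_classical all_reals all_analysis.
Set Implicit Arguments. Unset Strict Implicit. Unset Printing Implicit Defensive.
Import Order.TTheory GRing.Theory Num.Theory.
Import numFieldNormedType.Exports.
Local Open Scope classical_set_scope.
Local Open Scope ring_scope.

(* R^3 is modelled as (R * R) * R, with the product sigma-algebra
   (= Borel sigma-algebra of R^3) and the product Lebesgue measure. *)
Definition pt3 (R : realType) := ((R * R) * R)%type.

Definition leb3 (R : realType) :=
  ((@lebesgue_measure R \x @lebesgue_measure R) \x @lebesgue_measure R)%E.

Definition dist2 (R : realType) (x y : pt3 R) : R :=
  (y.1.1 - x.1.1) ^+ 2 + (y.1.2 - x.1.2) ^+ 2 + (y.2 - x.2) ^+ 2.

Definition g3 (R : realType) (t : R) (x y : pt3 R) : R :=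
  (4 * pi * t) `^ (- (3 / 2)) * expR (- dist2 x y / (4 * t)).

Definition Ioo0 (R : realType) (t : R) : set R := `]0, t[.

Definition Sfun (R : realType) (V : pt3 R -> R) (t : R) (x y : pt3 R) : \bar R :=
  (\int[@lebesgue_measure R]_(s in Ioo0 t)
     \int[@leb3 R]_z (g3 s x z * g3 (t - s) z y / g3 t x y * `|V z|)%:E)%E.

Definition Snorm (R : realType) (V : pt3 R -> R) (t : R) : \bar R :=
  ereal_sup [set Sfun V t x y | x in [set: pt3 R] & y in [set: pt3 R]].

Definition katoSup (R : realType) (V : pt3 R -> R) (t : R) : \bar R :=
  ereal_sup [set (\int[@lebesgue_measure R]_(s in Ioo0 t)
                    \int[@leb3 R]_z (g3 s x z * `|V z|)%:E)%E | x in [set: pt3 R]].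

Definition Kato3 (R : realType) (V : pt3 R -> R) : Prop :=
  katoSup V t @[t --> 0^'+] --> (0%R)%:E.

(* Main.v *)
Require Import Defs.
From HB Require Import structures.
From mathcomp Require Import all_boot all_order all_algebra.
From mathcomp Require Import all_classical all_reals all_analysis.
From mathcomp Require Import measurable_realfun ring lra.
Set Implicit Arguments. Unset Strict Implicit. Unset Printing Implicit Defensive.
Import Order.TTheory GRing.Theory Num.Theory.
Local Open Scope classical_set_scope.
Local Open Scope ring_scope.

(** A Brownian bridge from [x] to [y] in time [t] with [y - x = N t e_1] and [N]
    large follows, up to time [t/2], the axis through [x] with speed [N] and has
    transversal spread [sqrt (u/N)] at distance [u], so it charges [z] with
    weight [1/u] inside a thin paraboloid. Put potential of height [e 4^j/j] on
    the box at distance [N 4^-j] from [x], of length comparable to this distance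
    and of transversal radius [2^-j], for each [j] from [n + 2] to [K], with
    [N = 4^K]. A bridge that starts at [x] picks up a fixed multiple of [e/j] in
    the box [j] as soon as [t >= 4 4^-j], hence [e (1/(n + 2) + ... + 1/K)] in
    total, which is arbitrarily large for suitable [K]. A Brownian path that is
    observed during a unit of time sees the box [j] with probability at most
    [min (1, 4^-j/s)] at time [s], so its expected gain there is at most
    [e 4^j/j] times [(1 + 4 j) 4^-j]; since the boxes are spread along the axis,
    the total gain is [O(e)] uniformly in [K] and in the starting point. The
    potential is a sum of such tubes on parallel axes with [e = 2^-n]: each tube
    is bounded and the tail of the series is uniformly small, which gives the
    Kato condition, while [n] tends to infinity with [e (1/(n + 2) + ... + 1/K)]
    at least [n]. *)

(** * Double integrals against a kernel *)

Section product_sigma_finite.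
Local Open Scope ereal_scope.
Context d1 d2 (T1 : measurableType d1) (T2 : measurableType d2) (R : realType).
Variable m1 : {measure set T1 -> \bar R}.
Variable m2 : {sigma_finite_measure set T2 -> \bar R}.

(** Diagonal rectangles suffice because both exhaustions are nondecreasing: a point with coordinates
    in [F i] and [G j] lies in the rectangle of index [maxn i j]. *)
Lemma product_measure1_sigma_finite :
  sigma_finite setT m1 -> sigma_finite setT (m1 \x m2).
Proof.
move=> /sigma_finiteP[F [FT ndF Foo]].
have /sigma_finiteP[G [GT ndG Goo]] := sigma_finiteT m2.
exists (fun n => F n `*` G n) => [|n]; last first.
  have [mF F_lty] := Foo n; have [mG G_lty] := Goo n; split.
    exact: measurableX.
  by rewrite product_measure1E// lte_mul_pinfty// ge0_fin_numE.
rewrite -setXTT FT GT; apply/seteqP; split=> [[x y] [/= [i _ Fx] [j _ Gy]]|].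
  exists (maxn i j) => //; split=> /=.
    by move: Fx; apply/subsetPset/ndF/leq_maxl.
  by move: Gy; apply/subsetPset/ndG/leq_maxr.
by move=> [x y] [n _ [Fx Gy]]; split; exists n.
Qed.

End product_sigma_finite.

(* The library's own instance on [m1 \x m2] is found only for finite factors,
   hence the instances on the constants [leb2] and [leb3]. *)
Definition leb2 (R : realType) :=
  (@lebesgue_measure R \x @lebesgue_measure R)%E.

HB.instance Definition _ (R : realType) := Measure.on (@leb2 R).
HB.instance Definition _ (R : realType) :=
  @Measure_isSigmaFinite.Build _ _ _ (@leb2 R)
    (product_measure1_sigma_finite (@lebesgue_measure R)
      (sigma_finiteT (@lebesgue_measure R))).

HB.instance Definition _ (R : realType) := Measure.on (@leb3 R).
HB.instance Definition _ (R : realType) :=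
  @Measure_isSigmaFinite.Build _ _ _ (@leb3 R)
    (product_measure1_sigma_finite (@lebesgue_measure R)
      (sigma_finiteT (@leb2 R))).

Section double_integral.
Context {R : realType}.
Implicit Types (k : R -> pt3 R -> R) (f : pt3 R -> \bar R) (D : set R).

(** Common form of the Kato integral and of [Sfun], which differ only in the kernel. [f] is
    extended-valued so that an infinite series of tubes can be inserted directly. *)
Definition double_int D k f : \bar R :=
  (\int[@lebesgue_measure R]_(s in D) \int[@leb3 R]_z ((k s z)%:E * f z))%E.

(** Both properties are asked for all real [s]; [g3] has them even for [s <= 0], since [powR] and
    [expR] are never negative. *)
Definition is_kernel k :=
  measurable_fun [set: R * pt3 R] (fun p : R * pt3 R => k p.1 p.2) /\
  forall s z, 0 <= k s z.

Lemma measurable_kernel_row k s : is_kernel k -> measurable_fun [set: pt3 R] (k s).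
Proof. by case=> mk _; exact: (measurableT_comp mk (measurable_pair1 s)). Qed.

Lemma measurable_inner_int k f : is_kernel k ->
  measurable_fun [set: pt3 R] f -> (forall z, 0 <= f z)%E ->
  measurable_fun setT (fun s => \int[@leb3 R]_z ((k s z)%:E * f z))%E.
Proof.
move=> [mk k0] mf f0.
apply: (@measurable_fun_fubini_tonelli_F _ _ _ _ R (@leb3 R)
  (fun p : R * pt3 R => (k p.1 p.2)%:E * f p.2)%E).
  apply: emeasurable_funM; first exact/measurable_EFinP.
  exact: (measurableT_comp mf measurable_snd).
by move=> p; rewrite mule_ge0// lee_fin.
Qed.

Lemma inner_int_le k f g s : is_kernel k ->
  measurable_fun [set: pt3 R] f -> (forall z, 0 <= f z)%E ->
  measurable_fun [set: pt3 R] g -> (forall z, f z <= g z)%E ->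
  (\int[@leb3 R]_z ((k s z)%:E * f z) <= \int[@leb3 R]_z ((k s z)%:E * g z))%E.
Proof.
move=> kk mf f0 mg fg; have [mk k0] := kk.
have ms : measurable_fun setT (EFin \o k s).
  by apply/measurable_EFinP; exact: measurable_kernel_row.
apply: ge0_le_integral => //.
- by move=> z _; rewrite mule_ge0// lee_fin.
- exact: emeasurable_funM.
- exact: emeasurable_funM.
- by move=> z _; rewrite lee_pmul// lee_fin.
Qed.

Lemma double_int_le D k f g : measurable D -> is_kernel k ->
  measurable_fun [set: pt3 R] f -> (forall z, 0 <= f z)%E ->
  measurable_fun [set: pt3 R] g -> (forall z, f z <= g z)%E ->
  (double_int D k f <= double_int D k g)%E.
Proof.
move=> mD kk mf f0 mg fg; have [mk k0] := kk.
have g0 z : (0 <= g z)%E := le_trans (f0 z) (fg z).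
apply: ge0_le_integral => //.
- by move=> s _; apply: integral_ge0 => z _; rewrite mule_ge0// lee_fin.
- by apply: measurable_funTS; exact: measurable_inner_int.
- by apply: measurable_funTS; exact: measurable_inner_int.
- by move=> s _; exact: inner_int_le.
Qed.

Lemma double_int_nneseries D k (f : nat -> pt3 R -> \bar R) :
  measurable D -> is_kernel k ->
  (forall n, measurable_fun [set: pt3 R] (f n)) -> (forall n z, 0 <= f n z)%E ->
  double_int D k (fun z => \sum_(n <oo) f n z)%E =
  (\sum_(n <oo) double_int D k (f n))%E.
Proof.
move=> mD kk mf f0; have [mk k0] := kk.
rewrite /double_int -integral_nneseries//.
- apply: eq_integral => s _; rewrite -integral_nneseries//.
  + by apply: eq_integral => z _; rewrite nneseriesZl.
  + move=> n; apply: emeasurable_funM; last exact: mf.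
    by apply/measurable_EFinP; exact: measurable_kernel_row.
  + by move=> n z _; rewrite mule_ge0// lee_fin.
- by move=> n; apply: measurable_funTS; exact: measurable_inner_int.
- move=> n s _; apply: integral_ge0 => z _; by rewrite mule_ge0// lee_fin.
Qed.

Lemma double_int_sum D k (I : Type) (r : seq I) (f : I -> pt3 R -> \bar R) :
  measurable D -> is_kernel k ->
  (forall i, measurable_fun [set: pt3 R] (f i)) -> (forall i z, 0 <= f i z)%E ->
  double_int D k (fun z => \sum_(i <- r) f i z)%E =
  (\sum_(i <- r) double_int D k (f i))%E.
Proof.
move=> mD kk mf f0; have [mk k0] := kk.
rewrite /double_int -ge0_integral_sum//.
- apply: eq_integral => s _; rewrite -ge0_integral_sum//.
  + by apply: eq_integral => z _; rewrite ge0_sume_distrr.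
  + move=> n; apply: emeasurable_funM; last exact: mf.
    by apply/measurable_EFinP; exact: measurable_kernel_row.
  + by move=> n z _; rewrite mule_ge0// lee_fin.
- by move=> n; apply: measurable_funTS; exact: measurable_inner_int.
- move=> n s _; apply: integral_ge0 => z _; by rewrite mule_ge0// lee_fin.
Qed.

Lemma double_intZ D k f c : measurable D -> is_kernel k ->
  measurable_fun [set: pt3 R] f -> (forall z, 0 <= f z)%E -> 0 <= c ->
  double_int D k (fun z => c%:E * f z)%E = (c%:E * double_int D k f)%E.
Proof.
move=> mD kk mf f0 c0; have [mk k0] := kk.
rewrite /double_int -ge0_integralZl_EFin//; last 2 first.
- by move=> s _; apply: integral_ge0 => z _; rewrite mule_ge0// lee_fin.
- by apply: measurable_funTS; exact: measurable_inner_int.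
apply: eq_integral => s _; rewrite -ge0_integralZl_EFin//.
- by apply: eq_integral => z _; rewrite muleCA.
- by move=> z _; rewrite mule_ge0// lee_fin.
- apply: emeasurable_funM; last exact: mf.
  by apply/measurable_EFinP; exact: measurable_kernel_row.
Qed.

Lemma leb3_tensor (a b c : R -> R) :
  measurable_fun setT a -> measurable_fun setT b -> measurable_fun setT c ->
  (forall u, 0 <= a u) -> (forall u, 0 <= b u) -> (forall u, 0 <= c u) ->
  (\int[@leb3 R]_z (a z.1.1 * b z.1.2 * c z.2)%:E =
   \int[@lebesgue_measure R]_u (a u)%:E * \int[@lebesgue_measure R]_u (b u)%:E
   * \int[@lebesgue_measure R]_u (c u)%:E)%E.
Proof.
move=> ma mb mc a0 b0 c0.
have mab : measurable_fun setT (fun w : R * R => a w.1 * b w.2).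
  by apply: measurable_funM; [exact: (measurableT_comp ma measurable_fst)
                             |exact: (measurableT_comp mb measurable_snd)].
rewrite [LHS](@fubini_tonelli1 _ _ _ _ R (@leb2 R) (@lebesgue_measure R)
  (fun z : pt3 R => (a z.1.1 * b z.1.2 * c z.2)%:E)).
- rewrite /fubini_F /=.
  under eq_integral => w _.
    under eq_integral do rewrite EFinM.
    rewrite ge0_integralZl//; last 3 first.
    + exact/measurable_EFinP.
    + by move=> u _; rewrite lee_fin.
    + by rewrite lee_fin mulr_ge0.
    over.
  rewrite /= ge0_integralZr//; last 3 first.
  + exact/measurable_EFinP.
  + by move=> w _; rewrite lee_fin mulr_ge0.
  + by apply: integral_ge0 => u _; rewrite lee_fin.
  congr (_ * _)%E.
  rewrite [LHS](@fubini_tonelli1 _ _ _ _ R (@lebesgue_measure R)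
    (@lebesgue_measure R) (fun w : R * R => (a w.1 * b w.2)%:E)).
  + rewrite /fubini_F /=.
    under eq_integral => w _.
      under eq_integral do rewrite EFinM.
      rewrite ge0_integralZl//; last 3 first.
      * exact/measurable_EFinP.
      * by move=> u _; rewrite lee_fin.
      * by rewrite lee_fin.
      over.
    rewrite /= ge0_integralZr//; last 3 first.
    * exact/measurable_EFinP.
    * by move=> w _; rewrite lee_fin.
    * by apply: integral_ge0 => u _; rewrite lee_fin.
  + exact/measurable_EFinP.
  + by move=> w; rewrite lee_fin mulr_ge0.
- apply/measurable_EFinP; apply: measurable_funM.
    exact: (measurableT_comp mab measurable_fst).
  exact: (measurableT_comp mc measurable_snd).
- by move=> w; rewrite lee_fin !mulr_ge0.
Qed.

End double_integral.

(** * Heat kernel *)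

Section heat_kernel.
Context {R : realType}.
Implicit Types (s t a u w r : R) (x y z : pt3 R).

(** The one-dimensional heat kernel as a normal density of variance [2 * s], so that measurability
    and unit mass come from the theory of normal laws. *)
Definition heat s a u : R := normal_pdf a (Num.sqrt (2 * s)) u.

Lemma heatE s a u : 0 < s ->
  heat s a u = (Num.sqrt (4 * pi * s))^-1 * expR (- (u - a) ^+ 2 / (4 * s)).
Proof.
move=> s0; have s20 : 0 < 2 * s by rewrite mulr_gt0.
rewrite /heat normal_pdfE ?gt_eqF ?sqrtr_gt0//.
rewrite /normal_peak /normal_fun sqr_sqrtr ?ltW//; congr (_^-1 * expR _).
  by congr Num.sqrt; rewrite -mulr_natr; ring.
by congr (_ / _); rewrite -mulr_natr; ring.
Qed.

Lemma heat_ge0 s a u : 0 <= heat s a u.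
Proof. exact: normal_pdf_ge0. Qed.

Lemma measurable_heat s a : measurable_fun [set: R] (heat s a).
Proof. exact: measurable_normal_pdf. Qed.

Lemma integral_heat s a : (\int[@lebesgue_measure R]_u (heat s a u)%:E = 1)%E.
Proof. exact: integral_normal_pdf. Qed.

Lemma powR_pos_m32 a : 0 < a -> a `^ (- (3 / 2)) = (Num.sqrt a)^-1 ^+ 3.
Proof.
move=> a0; rewrite powRN exprVn; congr (_^-1).
rewrite -powR12_sqrt ?ltW// -powR_mulrn ?powR_ge0// -powRrM.
by congr (_ `^ _); rewrite mulrC.
Qed.

Lemma g3E s x z : 0 < s ->
  g3 s x z = heat s x.1.1 z.1.1 * heat s x.1.2 z.1.2 * heat s x.2 z.2.
Proof.
move=> s0; rewrite !heatE// /g3 powR_pos_m32 ?mulr_gt0 ?pi_gt0//.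
set c := _^-1; rewrite -!mulrA.
have -> : expR (- dist2 x z / (4 * s)) = expR (- (z.1.1 - x.1.1) ^+ 2 / (4 * s)) *
   expR (- (z.1.2 - x.1.2) ^+ 2 / (4 * s)) * expR (- (z.2 - x.2) ^+ 2 / (4 * s)).
  by rewrite -!expRD /dist2; congr expR; ring.
by ring.
Qed.

Lemma g3_ge0 s x z : 0 <= g3 s x z.
Proof. by rewrite mulr_ge0 ?powR_ge0 ?expR_ge0. Qed.

(** Inversion is continuous only away from 0, so the point 0 is treated separately. *)
Lemma measurable_invr : measurable_fun [set: R] (@GRing.inv R).
Proof.
rewrite -(setUv [set 0]); apply/measurable_funU => //; first exact: measurableC.
split; first exact: measurable_fun_set1.
apply: open_continuous_measurable_fun => [|u /set_mem/eqP u0].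
  by rewrite openC; exact: closed_eq.
exact: inv_continuous.
Qed.

Lemma measurable_g3 (a : R * pt3 R -> R) (b c : R * pt3 R -> pt3 R) :
  measurable_fun setT a -> measurable_fun setT b -> measurable_fun setT c ->
  measurable_fun [set: R * pt3 R] (fun p => g3 (a p) (b p) (c p)).
Proof.
move=> ma mb mc.
have m1 (h : R * pt3 R -> pt3 R) : measurable_fun setT h ->
    [/\ measurable_fun setT (fun p => (h p).1.1),
        measurable_fun setT (fun p => (h p).1.2) &
        measurable_fun setT (fun p => (h p).2)].
  move=> mh; split.
  - exact: (measurableT_comp measurable_fst (measurableT_comp measurable_fst mh)).
  - exact: (measurableT_comp measurable_snd (measurableT_comp measurable_fst mh)).
  - exact: (measurableT_comp measurable_snd mh).
have [b1 b2 b3] := m1 _ mb; have [c1 c2 c3] := m1 _ mc.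
apply: measurable_funM.
  apply: (measurableT_comp (measurable_powR _)).
  by apply: measurable_funM => //; exact: measurable_cst.
apply: measurableT_comp => //; apply: measurable_funM.
  apply: measurableT_comp => //; apply: measurable_funD; first apply: measurable_funD;
  by apply: measurable_funX; exact: measurable_funB.
apply: (measurableT_comp measurable_invr).
by apply: measurable_funM => //; exact: measurable_cst.
Qed.

Lemma g3_kernel x : is_kernel (fun s z => g3 s x z).
Proof.
split; last by move=> ? ?; exact: g3_ge0.
apply: measurable_g3; [exact: measurable_fst|exact: measurable_cst|].
exact: measurable_snd.
Qed.

Lemma bridge_kernel t x y :
  is_kernel (fun s z => g3 s x z * g3 (t - s) z y / g3 t x y).
Proof.
split; last first.
  by move=> s z; rewrite divr_ge0 ?g3_ge0// mulr_ge0 ?g3_ge0.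
apply: measurable_funM; last exact: measurable_cst.
apply: measurable_funM; apply: measurable_g3; try exact: measurable_cst.
- exact: measurable_fst.
- exact: measurable_snd.
- by apply: measurable_funB; [exact: measurable_cst|exact: measurable_fst].
- exact: measurable_snd.
Qed.

Definition heat_mass s a (I : set R) : \bar R :=
  (\int[@lebesgue_measure R]_u (heat s a u * \1_I u)%:E)%E.

Lemma heat_mass_ge0 s a I : (0 <= heat_mass s a I)%E.
Proof. by apply: integral_ge0 => u _; rewrite lee_fin mulr_ge0 ?heat_ge0. Qed.

Lemma measurable_heat_indic s a (I : set R) : measurable I ->
  measurable_fun [set: R] (fun u => heat s a u * \1_I u).
Proof.
move=> mI; apply: measurable_funM; first exact: measurable_heat.
exact: measurable_indic.
Qed.

Lemma indic_le1 T (I : set T) (u : T) : (\1_I u : R) <= 1.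
Proof. by rewrite indicE; case: (_ \in _). Qed.

Lemma heat_mass_le1 s a (I : set R) : measurable I -> (heat_mass s a I <= 1)%E.
Proof.
move=> mI; rewrite -(integral_heat s a); apply: ge0_le_integral => //.
- by move=> u _; rewrite lee_fin mulr_ge0 ?heat_ge0.
- by apply/measurable_EFinP; exact: measurable_heat_indic.
- by apply/measurable_EFinP; exact: measurable_heat.
- by move=> u _; rewrite lee_fin ler_piMr ?heat_ge0 ?indic_le1.
Qed.

Lemma pi_ge1 : 1 <= pi :> R.
Proof. by have := @pi_ge2 R; lra. Qed.

(** The density is at most its peak [1 / sqrt (4 pi s)] and the interval has length [2 r]; the
    remaining factor [1 / sqrt pi] is at most 1. *)
Lemma heat_mass_short s a u r : 0 < s -> 0 <= r ->
  (heat_mass s a `[(u - r)%R, (u + r)%R] <= (r / Num.sqrt s)%:E)%E.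
Proof.
move=> s0 r0.
have /le_trans : (heat_mass s a `[(u - r)%R, (u + r)%R] <=
  \int[@lebesgue_measure R]_v
     ((Num.sqrt (4 * pi * s))^-1%:E * (\1_(`[(u - r)%R, (u + r)%R]%classic) v)%:E))%E.
  apply: ge0_le_integral => //.
  - by move=> v _; rewrite lee_fin mulr_ge0 ?heat_ge0.
  - by apply/measurable_EFinP; exact: measurable_heat_indic.
  - apply: emeasurable_funM => //.
    by apply/measurable_EFinP; exact: measurable_indic.
  - move=> v _; rewrite -EFinM lee_fin ler_wpM2r//.
    rewrite heatE// ler_piMr ?invr_ge0 ?sqrtr_ge0// expR_le1.
    by rewrite mulNr oppr_le0 divr_ge0 ?sqr_ge0// ?mulr_ge0 ?ltW.
apply; rewrite ge0_integralZl_EFin ?invr_ge0 ?sqrtr_ge0//; last first.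
  by apply/measurable_EFinP; exact: measurable_indic.
rewrite integral_indic//= setIT lebesgue_measure_itv/= lte_fin.
case: ifPn => [_|_]; last by rewrite mule0 lee_fin divr_ge0 ?sqrtr_ge0.
rewrite -EFinD -EFinM lee_fin.
have -> : 4 * pi * s = 2 ^+ 2 * (pi * s) by ring.
rewrite sqrtrM ?sqr_ge0// sqrtr_sqr ger0_norm// sqrtrM ?pi_ge0//.
have p1 : 1 <= Num.sqrt pi :> R by rewrite -[leLHS]sqrtr1 ler_wsqrtr ?pi_ge1.
have ss : 0 < Num.sqrt s by rewrite sqrtr_gt0.
have -> : (2 * (Num.sqrt pi * Num.sqrt s))^-1 * (u + r - (u - r)) =
  r / Num.sqrt s / Num.sqrt pi.
  by field; rewrite !gt_eqF// (lt_le_trans _ p1).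
by rewrite ler_pdivrMr ?(lt_le_trans _ p1)// ler_peMr// divr_ge0// ltW.
Qed.

(* [exp(-v) <= exp(-v/2)/(1 + v/2)] trades half of the exponent for polynomial
   decay that no longer depends on [s]. *)
Lemma heat_le_double s a u : 0 < s -> s <= 1 ->
  heat s a u <= 2 * (8 / (8 + (u - a) ^+ 2)) * heat (2 * s) a u.
Proof.
move=> s0 s1; rewrite !heatE ?mulr_gt0//.
have -> : Num.sqrt (4 * pi * (2 * s)) = Num.sqrt 2 * Num.sqrt (4 * pi * s).
  by rewrite -sqrtrM//; congr Num.sqrt; ring.
have q0 : 0 < Num.sqrt (4 * pi * s) by rewrite sqrtr_gt0 !mulr_gt0 ?pi_gt0.
have s2 : 0 < Num.sqrt 2 :> R by rewrite sqrtr_gt0.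
have s22 : Num.sqrt 2 <= 2 :> R.
  by rewrite -[leRHS]ger0_norm// -sqrtr_sqr ler_wsqrtr//; lra.
set d := (u - a) ^+ 2; have d0 : 0 <= d by exact: sqr_ge0.
set e := expR (- d / (4 * (2 * s))).
have -> : expR (- d / (4 * s)) = e * e.
  by rewrite -expRD; congr expR; field; rewrite gt_eqF.
have e0 : 0 < e by exact: expR_gt0.
have e8 : e <= 8 / (8 + d).
  rewrite /e mulNr expRN -[leRHS]invf_div lef_pV2 ?posrE ?expR_gt0 ?divr_gt0//;
    last first.
    by rewrite ltr_wpDr.
  apply: le_trans (expR_ge1Dx _).
  have -> : (8 + d) / 8 = 1 + d / 8 by field.
  by rewrite lerD2l ler_wpM2l// lef_pV2 ?posrE ?mulr_gt0//; lra.
rewrite invfM.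
have -> : 2 * (8 / (8 + d)) * ((Num.sqrt 2)^-1 / Num.sqrt (4 * pi * s) * e) =
  (2 / Num.sqrt 2) * ((Num.sqrt (4 * pi * s))^-1 * (8 / (8 + d) * e)) by ring.
rewrite -[leLHS]mul1r ler_pM//.
  by rewrite !mulr_ge0 ?invr_ge0 ?sqrtr_ge0 ?expR_ge0.
  by rewrite ler_pdivlMr// mul1r.
by rewrite ler_pM2l ?invr_gt0// ler_pM2r.
Qed.

(** On [I] the kernel is at most [2 w] times the kernel at time [2 s], whose total mass is 1. The
    bound does not depend on [s]. *)
Lemma heat_mass_far s a w (I : set R) : measurable I -> 0 < s -> s <= 1 ->
  0 <= w -> (forall u, I u -> 8 / (8 + (u - a) ^+ 2) <= w) ->
  (heat_mass s a I <= (2 * w)%:E)%E.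
Proof.
move=> mI s0 s1 w0 Iw; rewrite -[leRHS]mule1 -(integral_heat (2 * s) a).
rewrite -ge0_integralZl//; last 3 first.
- by apply/measurable_EFinP; exact: measurable_heat.
- by move=> u _; rewrite lee_fin heat_ge0.
- by rewrite lee_fin mulr_ge0.
apply: ge0_le_integral => //.
- by move=> u _; rewrite lee_fin mulr_ge0 ?heat_ge0.
- by apply/measurable_EFinP; exact: measurable_heat_indic.
- by apply: emeasurable_funM => //; apply/measurable_EFinP; exact: measurable_heat.
- move=> u _; rewrite -EFinM lee_fin indicE; have [uI|uI] := boolP (u \in I).
    rewrite mulr1 (le_trans (heat_le_double _ _ s0 s1))// ler_wpM2r ?heat_ge0//.
    by rewrite ler_pM2l// Iw// -inE.
  by rewrite mulr0 !mulr_ge0 ?heat_ge0.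
Qed.

End heat_kernel.

(** * Tubes: Kato bound and bridge bound *)

Section tubes.
Context {R : realType}.
Implicit Types (s t a u v w e b N : R) (x y z : pt3 R) (j K p : nat).

(** * Time spent in a thin transversal section *)

(** Bounds the probability that the two transversal coordinates lie in a square of half side [2^-j]
    at time [s]: each contributes [2^-j / sqrt s]. *)
Definition hit_prob j s : R := Num.min 1 (4^-1 ^+ j / s).

Lemma hit_prob_ge0 j s : 0 < s -> 0 <= hit_prob j s.
Proof. by move=> s0; rewrite le_min ler01 divr_ge0 ?exprn_ge0 ?ltW. Qed.

Lemma measurable_hit_prob j (D : set R) : measurable_fun D (hit_prob j).
Proof.
apply: measurable_funTS; apply: measurable_minr; first exact: measurable_cst.
by apply: measurable_funM; [exact: measurable_cst|exact: measurable_invr].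
Qed.

(** This recursion replaces the logarithm in the integral of [min (1, 4^-j / s)]: each step divides
    by 4 and adds at most [4^-j], which produces the factor [1 + 4 j]. *)
Lemma hit_prob_succ j s : 0 < s ->
  hit_prob j.+1 s <= 4^-1 * hit_prob j s + \1_(`]0, 4^-1 ^+ j]%classic) s.
Proof.
move=> s0; rewrite indicE; have [sj|sj] := leP s (4^-1 ^+ j).
  rewrite mem_set; last by rewrite /= in_itv/= s0.
  rewrite (@le_trans _ _ 1)//; first by rewrite ge_min lexx.
  by rewrite lerDr mulr_ge0// hit_prob_ge0.
rewrite memNset; last by rewrite /= in_itv/= s0/= leNgt sj.
rewrite addr0 /hit_prob [in leRHS]min_r; last by rewrite ler_pdivrMr// mul1r ltW.
by rewrite ge_min exprS mulrA lexx orbT.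
Qed.

Lemma integral_hit_prob j :
  (\int[@lebesgue_measure R]_(s in `]0%R, 1%R[) (hit_prob j s)%:E
    <= ((1 + 4 * j%:R) * 4^-1 ^+ j)%:E)%E.
Proof.
have m01 : measurable (`]0, 1[%classic : set R) by [].
have mh k : measurable_fun (`]0, 1[%classic : set R) (EFin \o hit_prob k).
  by apply/measurable_EFinP; exact: measurable_hit_prob.
have h0 k s : `]0, 1[%classic s -> (0 <= (hit_prob k s)%:E)%E.
  by rewrite /= in_itv/= lee_fin => /andP[s0 _]; exact: hit_prob_ge0.
have I0 : (\int[@lebesgue_measure R]_(s in `]0%R, 1%R[) (cst 1 s) = 1)%E.
  by rewrite integral_cst//= mul1e lebesgue_measure_itv/= lte_fin ltr01 oppr0 adde0.
elim: j => [|j IHj].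
  rewrite mulr0 addr0 mul1r expr0 -[leRHS]I0; apply: ge0_le_integral => //.
  - exact: h0.
  - exact: mh.
  - by move=> s _; rewrite lee_fin /hit_prob ge_min lexx.
have mI : measurable_fun (`]0, 1[%classic : set R)
    (EFin \o (\1_(`]0, 4^-1 ^+ j]%classic) : R -> R)).
  by apply/measurable_EFinP; exact: measurable_indic.
apply: (@le_trans _ _ (\int[@lebesgue_measure R]_(s in `]0%R, 1%R[)
    (4^-1%:E * (hit_prob j s)%:E +
     ((\1_(`]0%R, (4^-1 ^+ j)%R]%classic) : R -> R) s)%:E))%E).
  apply: ge0_le_integral => //.
  - exact: h0.
  - exact: mh.
  - apply: emeasurable_funD => //; apply: emeasurable_funM => //; exact: mh.
  - move=> s; rewrite /= in_itv/= => /andP[s0 _].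
    by rewrite -EFinM -EFinD lee_fin hit_prob_succ.
rewrite ge0_integralD//; last 2 first.
- by move=> s sI; apply: mule_ge0; [rewrite lee_fin|exact: h0].
- by apply: emeasurable_funM => //; exact: mh.
rewrite ge0_integralZl_EFin//; [|exact: h0|exact: mh].
apply: (@le_trans _ _ (4^-1%:E * ((1 + 4 * j%:R) * 4^-1 ^+ j)%:E + (4^-1 ^+ j)%:E))%E.
  apply: leeD; first by rewrite lee_pmul2l.
  rewrite integral_indic//=.
  rewrite (@le_trans _ _ (lebesgue_measure
    (`]0%R, (4^-1 ^+ j)%R]%classic : set R)))//.
    by rewrite le_measure ?inE//; exact: measurableI.
  by rewrite lebesgue_measure_itv/= lte_fin exprn_gt0// oppr0 adde0.
rewrite -EFinM -EFinD lee_fin exprS -natr1.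
by rewrite le_eqVlt; apply/orP; left; apply/eqP; field.
Qed.

(* Increasing and bounded by 1, so its increments over disjoint intervals add up
   to at most 2. *)
Definition squash v : R := v / (1 + `|v|).

Lemma squash_le1 v : `|squash v| <= 1.
Proof.
have v0 := normr_ge0 v; have v1 : 0 < 1 + `|v| by lra.
rewrite normrM normfV (gtr0_norm v1) ler_pdivrMr// mul1r; lra.
Qed.

(** Over the common denominator the surplus is [b |a| - a |b|], which vanishes when [a] and [b] have
    the same sign and is nonnegative when [a < 0 <= b]. *)
Lemma squash_incr a b : a <= b ->
  (b - a) / ((1 + `|a|) * (1 + `|b|)) <= squash b - squash a.
Proof.
move=> ab; have a0 := normr_ge0 a; have b0 := normr_ge0 b.
have a1 : 0 < 1 + `|a| by lra.
have b1 : 0 < 1 + `|b| by lra.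
have -> : squash b - squash a =
    (b - a + (b * `|a| - a * `|b|)) / ((1 + `|a|) * (1 + `|b|)).
  by rewrite /squash; field; rewrite !gt_eqF.
rewrite ler_pM2r ?invr_gt0 ?mulr_gt0// lerDl subr_ge0.
have [a0'|a0'] := ger0P a; have [b0'|b0'] := ger0P b.
- by rewrite mulrC.
- by have := le_lt_trans (le_trans a0' ab) b0'; rewrite ltxx.
- apply: (@le_trans _ _ 0); first by rewrite mulr_le0_ge0// ltW.
  by rewrite mulr_ge0// oppr_ge0 ltW.
- by rewrite !mulrN mulrC.
Qed.

(** Turns polynomial decay at a point into an increment of [squash] over an interval around it, so
    that decay factors of adjacent intervals can be summed by telescoping. *)
Lemma decay_le_squash a v b : a <= v -> v <= b -> 1 <= b - a ->
  8 / (8 + v ^+ 2) <= 40 * (squash b - squash a).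
Proof.
have key c d : c <= d -> 2^-1 <= d - c ->
    `|c| <= `|v| + 2^-1 -> `|d| <= `|v| + 2^-1 ->
    8 / (8 + v ^+ 2) <= 40 * (squash d - squash c).
  move=> cd cd2 cv dv.
  have v0 := normr_ge0 v; have c0 := normr_ge0 c; have d0 := normr_ge0 d.
  have c1 : 0 < 1 + `|c| by lra.
  have d1 : 0 < 1 + `|d| by lra.
  rewrite -(real_normK (num_real v)).
  set m := `|v| in v0 cv dv *.
  have m8 : 0 < 8 + m ^+ 2 by nra.
  rewrite (@le_trans _ _ (40 * ((d - c) / ((1 + `|c|) * (1 + `|d|)))))//; last first.
    by rewrite ler_pM2l// squash_incr.
  rewrite mulrA ler_pdivrMr// -mulrA mulrAC mulrA ler_pdivlMr ?mulr_gt0//.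
  have p1 : (1 + `|c|) * (1 + `|d|) <= (m + 3 / 2) * (m + 3 / 2).
    by apply: ler_pM; lra.
  have p2 : 2^-1 * (8 + m ^+ 2) <= (d - c) * (8 + m ^+ 2).
    by apply: ler_wpM2r => //; exact: ltW.
  (* With constant 40 the claim reduces to [20 (8 + m^2) >= 8 (m + 3/2)^2], whose difference is
     [12 (m - 1)^2 + 130]. *)
  have p3 : 0 <= (m - 1) ^+ 2 by exact: sqr_ge0.
  have p4 : (m - 1) ^+ 2 = m ^+ 2 - 2 * m + 1 by ring.
  rewrite p4 in p3.
  have p5 : (m + 3 / 2) * (m + 3 / 2) = m ^+ 2 + 3 * m + 9 / 4 by field.
  rewrite p5 in p1.
  have p6 : 40 * (d - c) * (8 + m ^+ 2) = 40 * ((d - c) * (8 + m ^+ 2)) by ring.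
  rewrite ?p6; lra.
have mono c d : c <= d -> squash c <= squash d.
  move=> cd; rewrite -subr_ge0 (le_trans _ (squash_incr cd))//.
  by rewrite divr_ge0 ?subr_ge0// mulr_ge0// addr_ge0.
move=> av vb ab.
have h2 : `|2^-1| = 2^-1 :> R by rewrite ger0_norm.
have np : `|v + 2^-1| <= `|v| + 2^-1 by rewrite (le_trans (ler_normD _ _))// h2.
have nm : `|v - 2^-1| <= `|v| + 2^-1 by rewrite (le_trans (ler_normB _ _))// h2.
(* As [b - a >= 1], a half-unit interval on one side of [v] fits into [[a, b]]. *)
have [h|h] := leP (v + 2^-1) b.
  apply: (@le_trans _ _ (40 * (squash (v + 2^-1) - squash v))).
    by apply: key => //; lra.
  by have := mono _ _ h; have := mono _ _ av; lra.
have h' : a <= v - 2^-1 by lra.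
apply: (@le_trans _ _ (40 * (squash v - squash (v - 2^-1)))).
  by apply: key => //; lra.
by have := mono _ _ h'; have := mono _ _ vb; lra.
Qed.

(** * Heat mass of the boxes *)

Lemma leb3_g3_tensor s x (I J L : set R) : 0 < s ->
  measurable I -> measurable J -> measurable L ->
  (\int[@leb3 R]_z ((g3 s x z)%:E * (\1_I z.1.1 * \1_J z.1.2 * \1_L z.2)%:E) =
   heat_mass s x.1.1 I * heat_mass s x.1.2 J * heat_mass s x.2 L)%E.
Proof.
move=> s0 mI mJ mL; rewrite -leb3_tensor; first last.
- by move=> u; rewrite mulr_ge0 ?heat_ge0.
- by move=> u; rewrite mulr_ge0 ?heat_ge0.
- by move=> u; rewrite mulr_ge0 ?heat_ge0.
- exact: measurable_heat_indic.
- exact: measurable_heat_indic.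
- exact: measurable_heat_indic.
apply: eq_integral => z _; rewrite -EFinM g3E//; congr (_%:E); ring.
Qed.

Lemma integral_g3 s x : 0 < s -> (\int[@leb3 R]_z (g3 s x z)%:E = 1)%E.
Proof.
move=> s0; have hm a : (heat_mass s a setT = 1)%E.
  rewrite -[RHS](integral_heat s a); apply: eq_integral => u _.
  by rewrite indicT mulr1.
have := @leb3_g3_tensor s x setT setT setT s0 measurableT measurableT measurableT.
rewrite !hm !mule1 => <-; apply: eq_integral => z _.
by rewrite !indicT !mulr1 mule1.
Qed.

(** For [j <= K] this runs from [N 4^-j] to [2 N 4^-j] with [N = 4^K], and has length at least 1. *)
Definition axis_seg K j : set R := `[4 ^+ (K - j), 2 * 4 ^+ (K - j)]%classic.

Definition cross_seg b j : set R := `[b - 2^-1 ^+ j, b + 2^-1 ^+ j]%classic.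

Definition box K b j z : R :=
  \1_(axis_seg K j) z.1.1 * \1_(cross_seg b j) z.1.2 * \1_(cross_seg 0 j) z.2.

Lemma measurable_axis_seg K j : measurable (axis_seg K j).
Proof. exact: measurable_itv. Qed.

Lemma measurable_cross_seg b j : measurable (cross_seg b j).
Proof. exact: measurable_itv. Qed.

#[local] Hint Resolve measurable_axis_seg measurable_cross_seg : core.

Lemma box_ge0 K b j z : 0 <= box K b j z.
Proof. by rewrite /box !mulr_ge0. Qed.

Lemma box_le1 K b j z : box K b j z <= 1.
Proof.
by apply: mulr_ile1; rewrite ?mulr_ge0 ?mulr_ile1 ?indic_le1.
Qed.

Lemma measurable_indic_tensor (I J L : set R) :
  measurable I -> measurable J -> measurable L ->
  measurable_fun [set: pt3 R]
    (fun z => \1_I z.1.1 * \1_J z.1.2 * \1_L z.2 : R).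
Proof.
move=> mI mJ mL.
have mi (A : set R) (h : pt3 R -> R) : measurable A ->
    measurable_fun setT h -> measurable_fun setT (fun z => \1_A (h z) : R).
  move=> mA mh; apply: (measurableT_comp _ mh); exact: measurable_indic.
apply: measurable_funM; first apply: measurable_funM; apply: mi => //.
- by apply: measurableT_comp => //; exact: measurable_fst.
- by apply: measurableT_comp => //; exact: measurable_fst.
Qed.

Lemma measurable_box K b j : measurable_fun [set: pt3 R] (box K b j).
Proof. exact: measurable_indic_tensor. Qed.

(** The mass factors by coordinates: the axial one gives [2 w], and the two transversal ones are
    bounded either by 1 or by their short-interval estimates. *)
Lemma box_g3_le K b j s x w : 0 < s -> s <= 1 -> 0 <= w ->
  (forall u, axis_seg K j u -> 8 / (8 + (u - x.1.1) ^+ 2) <= w) ->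
  (\int[@leb3 R]_z ((g3 s x z)%:E * (box K b j z)%:E)
    <= (2 * w * hit_prob j s)%:E)%E.
Proof.
move=> s0 s1 w0 xw; rewrite leb3_g3_tensor// -muleA [leRHS]EFinM.
apply: lee_pmul; first exact: heat_mass_ge0.
- by rewrite mule_ge0 ?heat_mass_ge0.
- exact: heat_mass_far.
have r0 : 0 <= 2^-1 ^+ j :> R by rewrite exprn_ge0.
have short a c := @heat_mass_short _ s a c _ s0 r0.
rewrite /hit_prob EFin_min le_min; apply/andP; split.
  by rewrite -[leRHS]mule1 lee_pmul ?heat_mass_ge0 ?heat_mass_le1.
have -> : 4^-1 ^+ j / s = (2^-1 ^+ j / Num.sqrt s) * (2^-1 ^+ j / Num.sqrt s) :> R.
  rewrite mulrACA -invfM -[_ * Num.sqrt s]expr2 sqr_sqrtr ?ltW//.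
  by rewrite -exprMn; congr (_ ^+ _ / _); field.
by rewrite EFinM lee_pmul ?heat_mass_ge0 ?short.
Qed.

(** The increment is over an interval that contains the axial segment shifted by [a] and abuts the
    interval of the neighbouring box. *)
Definition box_weight K j a : R :=
  40 * (squash (4 ^+ (K - j).+1 - a) - squash (4 ^+ (K - j) - a)).

Lemma axis_seg_weight K j a u : axis_seg K j u ->
  8 / (8 + (u - a) ^+ 2) <= box_weight K j a.
Proof.
rewrite /axis_seg /= in_itv/= => /andP[u1 u2].
have k1 : 1 <= 4 ^+ (K - j) :> R by rewrite exprn_ege1// ler1n.
by apply: decay_le_squash; rewrite ?exprS; lra.
Qed.

Lemma box_weight_ge0 K j a : 0 <= box_weight K j a.
Proof.
have k1 : 1 <= 4 ^+ (K - j) :> R by rewrite exprn_ege1// ler1n.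
apply: le_trans (@axis_seg_weight K j a (4 ^+ (K - j)) _); last first.
  by rewrite /axis_seg /= in_itv/= lexx/=; lra.
by rewrite divr_ge0// addr_ge0// sqr_ge0.
Qed.

Lemma sum_box_weight p K a : \sum_(p <= j < K.+1) box_weight K j a <= 80.
Proof.
have [pK|pK] := leqP p K.+1; last by rewrite big_geq// ltnW.
rewrite /box_weight -mulr_sumr.
(* For [j <= K], [K.+1 - j] is [(K - j).+1], so each weight is 40 times a difference of consecutive
   values of [H]; the total increment is at most 2. *)
pose H j := squash (4 ^+ (K.+1 - j) - a).
rewrite (@eq_big_nat _ _ _ _ _ _ (fun j => - (H j.+1 - H j))); last first.
  by move=> j /andP[_ jK]; rewrite opprB /H subSS subSn.
rewrite sumrN telescope_sumr//.
have := squash_le1 (4 ^+ (K.+1 - p) - a); have := squash_le1 (4 ^+ (K.+1 - K.+1) - a).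
rewrite -/(H p) -/(H K.+1) !ler_norml => /andP[? ?] /andP[? ?]; lra.
Qed.

Lemma double_box_le K b j x :
  (double_int `]0%R, 1%R[ (fun s z => g3 s x z) (fun z => (box K b j z)%:E)
    <= (2 * box_weight K j x.1.1 * ((1 + 4 * j%:R) * 4^-1 ^+ j))%:E)%E.
Proof.
have w0 : 0 <= 2 * box_weight K j x.1.1 by rewrite mulr_ge0// box_weight_ge0.
have m01 : measurable (`]0, 1[%classic : set R) by [].
apply: (@le_trans _ _ (\int[@lebesgue_measure R]_(s in `]0%R, 1%R[)
    ((2 * box_weight K j x.1.1)%:E * (hit_prob j s)%:E))%E).
  apply: ge0_le_integral => //.
  - move=> s _; apply: integral_ge0 => z _.
    by rewrite mule_ge0// lee_fin ?g3_ge0 ?box_ge0.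
  - apply: measurable_funTS.
    apply: (@measurable_inner_int _ (fun s z => g3 s x z)).
    + exact: g3_kernel.
    + by apply/measurable_EFinP; exact: measurable_box.
    + by move=> z; rewrite lee_fin box_ge0.
  - apply: emeasurable_funM => //; apply/measurable_EFinP.
    exact: measurable_hit_prob.
  - move=> s; rewrite /= in_itv/= => /andP[s0 s1]; rewrite -EFinM.
    by apply: box_g3_le; rewrite ?box_weight_ge0// ?ltW//; exact: axis_seg_weight.
rewrite ge0_integralZl_EFin//.
- by rewrite [leRHS]EFinM lee_wpmul2l// ?lee_fin// integral_hit_prob.
- by move=> s; rewrite /= in_itv/= lee_fin => /andP[s0 _]; exact: hit_prob_ge0.
- by apply/measurable_EFinP; exact: measurable_hit_prob.
Qed.

(** Multiplied by the time scale [4^-j] of a box this is [e / j]: harmonic gains for bridges, while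
    [(1 + 4 j) * (e / j) <= 5 e] for free paths. *)
Definition height e j : R := e * 4 ^+ j / j%:R.

Definition tube e p K b z : R :=
  \sum_(p <= j < K.+1) height e j * box K b j z.

Lemma height_ge0 e j : 0 <= e -> 0 <= height e j.
Proof. by move=> e0; rewrite divr_ge0// mulr_ge0// exprn_ge0. Qed.

Lemma tube_ge0 e p K b z : 0 <= e -> 0 <= tube e p K b z.
Proof.
by move=> e0; rewrite sumr_ge0// => j _; rewrite mulr_ge0 ?box_ge0 ?height_ge0.
Qed.

Lemma measurable_tube e p K b : measurable_fun [set: pt3 R] (tube e p K b).
Proof.
apply: measurable_sum => j; apply: measurable_funM; first exact: measurable_cst.
exact: measurable_box.
Qed.

Lemma double_int_tube D k e p K b : measurable D -> is_kernel k -> 0 <= e ->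
  (double_int D k (fun z => (tube e p K b z)%:E) =
   \sum_(p <= j < K.+1)
     (height e j)%:E * double_int D k (fun z => (box K b j z)%:E))%E.
Proof.
move=> mD kk e0.
have -> : (fun z => (tube e p K b z)%:E) =
    (fun z => \sum_(p <= j < K.+1) ((height e j)%:E * (box K b j z)%:E)%E)%E.
  by apply/funext => z; rewrite /tube -sumEFin.
rewrite double_int_sum//.
- apply: eq_bigr => j _; rewrite double_intZ ?height_ge0//.
  + by apply/measurable_EFinP; exact: measurable_box.
  + by move=> z; rewrite lee_fin box_ge0.
- move=> j; apply/measurable_EFinP; apply: measurable_funM.
    exact: measurable_cst.
  exact: measurable_box.
- by move=> j z; rewrite lee_fin mulr_ge0 ?box_ge0 ?height_ge0.
Qed.

(** The [1/j] in the height absorbs the growth [1 + 4 j], leaving [10 e] times the box weights,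
    whose sum is at most 80. *)
Lemma tube_kato_unit e p K b x : (0 < p)%N -> 0 <= e ->
  (double_int `]0%R, 1%R[ (fun s z => g3 s x z) (fun z => (tube e p K b z)%:E)
    <= (800 * e)%:E)%E.
Proof.
move=> p0 e0; rewrite double_int_tube//; last exact: g3_kernel.
apply: (@le_trans _ _ (\sum_(p <= j < K.+1) (10 * e * box_weight K j x.1.1)%:E)%E).
  rewrite big_nat_cond [leRHS]big_nat_cond; apply: lee_sum => j /andP[/andP[pj _] _].
  have j0 : (0 < j)%N := leq_trans p0 pj.
  have j1 : 1 <= j%:R :> R by rewrite ler1n.
  apply: (le_trans (lee_wpmul2l _ (double_box_le K b j x))).
    by rewrite lee_fin height_ge0.
  rewrite -EFinM lee_fin /height.
  have four : 4 ^+ j * 4^-1 ^+ j = 1 :> R by rewrite -exprMn divff// expr1n.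
  have w0 := box_weight_ge0 K j x.1.1.
  set w := box_weight K j x.1.1 in w0 *.
  have -> : e * 4 ^+ j / j%:R * (2 * w * ((1 + 4 * j%:R) * 4^-1 ^+ j)) =
     (2 * ((1 + 4 * j%:R) / j%:R)) * (e * w) * (4 ^+ j * 4^-1 ^+ j) by ring.
  rewrite four mulr1 -[leRHS]mulrA ler_wpM2r//; first exact: mulr_ge0.
  have : (1 + 4 * j%:R) / j%:R <= 5 :> R by rewrite ler_pdivrMr ?ltr0n//; lra.
  by lra.
rewrite sumEFin lee_fin -mulr_sumr.
have -> : 800 * e = 10 * e * 80 by ring.
by apply: ler_wpM2l; [lra|exact: sum_box_weight].
Qed.

Definition tube_sup e p K : R := \sum_(p <= j < K.+1) height e j.

Lemma tube_le_sup e p K b z : 0 <= e -> tube e p K b z <= tube_sup e p K.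
Proof.
by move=> e0; apply: ler_sum => j _; rewrite ler_piMr ?box_le1 ?height_ge0.
Qed.

(** The heat kernel has mass 1 at each time. This makes finitely many tubes negligible as [t] tends
    to 0. *)
Lemma bounded_kato t M x (f : pt3 R -> R) : 0 < t ->
  measurable_fun [set: pt3 R] f -> (forall z, 0 <= f z) -> (forall z, f z <= M) ->
  (double_int (Ioo0 t) (fun s z => g3 s x z) (fun z => (f z)%:E) <= (M * t)%:E)%E.
Proof.
move=> t0 mf f0 fM; have M0 : 0 <= M := le_trans (f0 x) (fM x).
have mI : measurable (Ioo0 t) by exact: measurable_itv.
have kk := g3_kernel x.
apply: (@le_trans _ _
  (double_int (Ioo0 t) (fun s z => g3 s x z) (fun z => M%:E * 1)%E)).
  apply: double_int_le => //; first exact/measurable_EFinP.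
    by move=> z; rewrite mule1 lee_fin.
rewrite double_intZ// [leRHS]EFinM lee_wpmul2l// ?lee_fin//.
rewrite (_ : double_int _ _ _ = \int[@lebesgue_measure R]_(s in Ioo0 t) (cst 1 s))%E.
  by rewrite integral_cst//= mul1e lebesgue_measure_itv/= lte_fin t0 oppr0 adde0.
apply: eq_integral => s; rewrite inE /Ioo0 /= in_itv/= => /andP[s0 _].
by under eq_integral do rewrite mule1; exact: integral_g3.
Qed.

(** * Lower bound along a bridge *)

(** The factor [8 pi] stems from [4 pi s <= 8 pi 4^-j] for [s <= 2 * 4^-j], the exponent from
    [bridge_exponent]. *)
Definition bridge_const : R := (Num.sqrt (8 * pi))^-1 ^+ 3 * expR (- (3 / 2)).

Lemma bridge_const_gt0 : 0 < bridge_const.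
Proof.
by rewrite mulr_gt0 ?expR_gt0// exprn_gt0// invr_gt0 sqrtr_gt0 mulr_gt0 ?pi_gt0.
Qed.

(* The bridge from [x] to [y] in time [t] is at time [s] Gaussian with mean
   [(s N, b, 0)] and variance [2 s (t - s) / t] in each coordinate. *)
Lemma bridge_exponent N b s t (z1 z2 z3 q : R) : 0 < q -> 4 * q <= t ->
  5 / 4 * q <= s -> s <= 7 / 4 * q ->
  (z1 - s * N) ^+ 2 <= q -> (z2 - b) ^+ 2 <= q -> z3 ^+ 2 <= q ->
  - (3 / 2) <= - dist2 ((0, b), 0) ((z1, z2), z3) / (4 * s)
    + - dist2 ((z1, z2), z3) ((N * t, b), 0) / (4 * (t - s))
    - - dist2 ((0, b), 0) ((N * t, b), 0 : R) / (4 * t).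
Proof.
move=> q0 qt qs sq u1 u2 u3.
have s0 : 0 < s by lra.
have t0 : 0 < t by lra.
have ts : 0 < t - s by lra.
rewrite /dist2/=.
have -> : - ((z1 - 0) ^+ 2 + (z2 - b) ^+ 2 + (z3 - 0) ^+ 2) / (4 * s)
    + - ((N * t - z1) ^+ 2 + (b - z2) ^+ 2 + (0 - z3) ^+ 2) / (4 * (t - s))
    - - ((N * t - 0) ^+ 2 + (b - b) ^+ 2 + (0 - 0) ^+ 2) / (4 * t) =
    - (((z1 - s * N) ^+ 2 + (z2 - b) ^+ 2 + z3 ^+ 2) * t / (4 * (s * (t - s)))).
  by field; rewrite !gt_eqF.
rewrite lerN2 ler_pdivrMr ?mulr_gt0//.
set U := _ + z3 ^+ 2.
have U3 : U * t <= 3 * q * t by apply: ler_wpM2r; [lra|rewrite /U; lra].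
have st : (5 / 4 * q) * (t / 2) <= s * (t - s) by apply: ler_pM; lra.
have qt0 : 0 < q * t by rewrite mulr_gt0.
have e1 : (5 / 4 * q) * (t / 2) = 5 / 8 * (q * t) by field.
have e2 : 3 * q * t = 3 * (q * t) by ring.
by rewrite e1 in st; rewrite e2 in U3; lra.
Qed.

Lemma sqrt_exp4 j : Num.sqrt (4^-1 ^+ j) = 2^-1 ^+ j :> R.
Proof.
have -> : 4^-1 ^+ j = (2^-1 ^+ j) ^+ 2 :> R.
  by rewrite -exprM mulnC exprM; congr (_ ^+ j); field.
by rewrite sqrtr_sqr ger0_norm ?exprn_ge0.
Qed.

(** The normalising factors at times [t - s] and [t] have quotient at least 1, so only the factor at
    time [s] remains, and it is of order [8^j]. *)
Lemma bridge_ge N b j s t (z1 z2 z3 : R) : 4 * 4^-1 ^+ j <= t ->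
  5 / 4 * 4^-1 ^+ j <= s -> s <= 7 / 4 * 4^-1 ^+ j ->
  (z1 - s * N) ^+ 2 <= 4^-1 ^+ j -> (z2 - b) ^+ 2 <= 4^-1 ^+ j ->
  z3 ^+ 2 <= 4^-1 ^+ j ->
  bridge_const * 8 ^+ j <=
  g3 s ((0, b), 0) ((z1, z2), z3) * g3 (t - s) ((z1, z2), z3) ((N * t, b), 0)
    / g3 t ((0, b), 0) ((N * t, b), 0 : R).
Proof.
set q := 4^-1 ^+ j; have q0 : 0 < q by rewrite exprn_gt0.
move=> qt qs sq u1 u2 u3.
have s0 : 0 < s by lra.
have t0 : 0 < t by lra.
have ts : 0 < t - s by lra.
have H := bridge_exponent q0 qt qs sq u1 u2 u3.
rewrite /g3 !powR_pos_m32 ?mulr_gt0 ?pi_gt0//.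
set Es := - dist2 _ _ / (4 * s) in H *.
set Ets := - dist2 _ _ / (4 * (t - s)) in H *.
set Et := - dist2 _ _ / (4 * t) in H *.
have pp : 0 < 4 * pi :> R by rewrite mulr_gt0 ?pi_gt0.
have r0 v : 0 < v -> 0 < Num.sqrt (4 * pi * v).
  by move=> v0; rewrite sqrtr_gt0 mulr_gt0.
set cs := (Num.sqrt (4 * pi * s))^-1 ^+ 3.
have cs0 : 0 < cs by rewrite exprn_gt0// invr_gt0 r0.
set cts := (Num.sqrt (4 * pi * (t - s)))^-1 ^+ 3.
set ct := (Num.sqrt (4 * pi * t))^-1 ^+ 3.
have ct0 : 0 < ct by rewrite exprn_gt0// invr_gt0 r0.
have cc : ct <= cts.
  rewrite lerXn2r ?nnegrE ?invr_ge0 ?sqrtr_ge0//.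
  by rewrite lef_pV2 ?posrE ?r0// ler_wsqrtr// ler_pM2l//; lra.
have -> : cs * expR Es * (cts * expR Ets) / (ct * expR Et) =
    cs * (cts / ct) * expR (Es + Ets - Et).
  rewrite !expRD expRN; field.
  by rewrite !gt_eqF ?expR_gt0.
rewrite /bridge_const mulrAC.
rewrite ler_pM ?mulr_ge0 ?exprn_ge0 ?invr_ge0 ?sqrtr_ge0 ?expR_ge0//;
  last by rewrite ler_expR.
rewrite (@le_trans _ _ cs)//; last first.
  by rewrite ler_peMr ?ler_pdivlMr ?mul1r// ltW.
have -> : 8 ^+ j = (2 ^+ j) ^+ 3 :> R.
  by rewrite -exprM mulnC exprM; congr (_ ^+ j); ring.
rewrite -exprMn lerXn2r ?nnegrE ?mulr_ge0 ?invr_ge0 ?sqrtr_ge0 ?exprn_ge0//.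
have -> : 2 ^+ j = (2^-1 ^+ j)^-1 :> R by rewrite exprVn invrK.
rewrite -invfM -sqrt_exp4 -sqrtrM ?mulr_ge0 ?pi_ge0//.
rewrite lef_pV2 ?posrE ?r0// ?sqrtr_gt0 ?mulr_gt0 ?pi_gt0//.
rewrite ler_wsqrtr//.
have -> : 8 * pi * 4^-1 ^+ j = 4 * pi * (2 * q) by rewrite -/q; ring.
by rewrite ler_pM2l//; lra.
Qed.

Lemma leb1_cross_seg b j :
  (\int[@lebesgue_measure R]_u ((\1_(cross_seg b j) : R -> R) u)%:E =
   (2 * 2^-1 ^+ j)%:E)%E.
Proof.
have r0 : 0 < 2^-1 ^+ j :> R by rewrite exprn_gt0.
rewrite integral_indic; [|exact: measurableT|exact: measurable_cross_seg].
rewrite setIT [LHS]lebesgue_measure_itv/= lte_fin ifT; last lra.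
by rewrite -EFinD; congr (_%:E); ring.
Qed.

Definition bridge_start b : pt3 R := ((0, b), 0).

(** The endpoint moves with [t] so that the mean speed is [4^K] for every duration. *)
Definition bridge_end K b t : pt3 R := ((4 ^+ K * t, b), 0).

Definition bridge K b t s z : R :=
  g3 s (bridge_start b) z * g3 (t - s) z (bridge_end K b t)
  / g3 t (bridge_start b) (bridge_end K b t).

(** The density is at least [bridge_const * 8^j] on a cube of volume [8 * 8^-j] centred at the mean
    of the bridge, and in this time window the cube lies in the box. *)
Lemma inner_bridge_ge K b j s t : (1 < j)%N -> (j <= K)%N ->
  4 * 4^-1 ^+ j <= t -> 5 / 4 * 4^-1 ^+ j <= s -> s <= 7 / 4 * 4^-1 ^+ j ->
  ((8 * bridge_const)%:E <=
   \int[@leb3 R]_z ((bridge K b t s z)%:E * (box K b j z)%:E))%E.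
Proof.
move=> j2 jK qt qs sq.
have k0 := bridge_const_gt0.
have r0 : 0 < 2^-1 ^+ j :> R by rewrite exprn_gt0.
(* This is where [j >= 2] matters: the centre has first coordinate between [5/4] and [7/4] times
   [4^(K-j) >= 1], so a half side of at most [1/4] keeps the cube in the axial segment. *)
have r4 : 2^-1 ^+ j <= 4^-1 :> R.
  rewrite (_ : 4^-1 = 2^-1 ^+ 2); last by field.
  by rewrite ler_wiXn2l// invf_le1 ?ler1n.
have qE : 4^-1 ^+ j = (2^-1 ^+ j) ^+ 2 :> R.
  by rewrite -exprM mulnC exprM; congr (_ ^+ j); field.
have NE : 4^-1 ^+ j * 4 ^+ K = 4 ^+ (K - j) :> R.
  by rewrite -(subnK jK) exprD addnK mulrC -mulrA -exprMn divff// expr1n mulr1.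
have k1 : 1 <= 4 ^+ (K - j) :> R by rewrite exprn_ege1// ler1n.
have [kk kk0] := bridge_kernel t (bridge_start b) (bridge_end K b t).
pose cube z : R := \1_(cross_seg (s * 4 ^+ K) j) z.1.1 *
  \1_(cross_seg b j) z.1.2 * \1_(cross_seg 0 j) z.2.
have cube0 z : 0 <= cube z by rewrite /cube !mulr_ge0.
have mcube : measurable_fun [set: pt3 R] cube.
  by apply: measurable_indic_tensor.
apply: (@le_trans _ _ (\int[@leb3 R]_z ((bridge_const * 8 ^+ j)%:E * (cube z)%:E))%E).
  rewrite ge0_integralZl_EFin//; last 3 first.
  - by move=> z _; rewrite lee_fin.
  - exact/measurable_EFinP.
  - by rewrite mulr_ge0 ?exprn_ge0// ltW.
  have mc c : measurable_fun [set: R] (\1_(cross_seg c j) : R -> R).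
    by apply: measurable_indic; exact: measurable_cross_seg.
  rewrite leb3_tensor//.
  rewrite !leb1_cross_seg -!EFinM lee_fin.
  have e8 : 8 ^+ j * (2^-1 ^+ j * 2^-1 ^+ j * 2^-1 ^+ j) = 1 :> R.
    by rewrite -!exprMn (_ : 8 * _ = 1) ?expr1n//; field.
  have -> : bridge_const * 8 ^+ j *
      (2 * 2^-1 ^+ j * (2 * 2^-1 ^+ j) * (2 * 2^-1 ^+ j)) =
     8 * bridge_const * (8 ^+ j * (2^-1 ^+ j * 2^-1 ^+ j * 2^-1 ^+ j)) by ring.
  by rewrite e8 mulr1.
have mk : measurable_fun [set: pt3 R] (fun z => bridge K b t s z).
  exact: (measurable_kernel_row s (bridge_kernel t _ _)).
apply: ge0_le_integral => //.
- by move=> z _; rewrite -EFinM lee_fin mulr_ge0// mulr_ge0 ?exprn_ge0// ltW.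
- by apply: emeasurable_funM => //; exact/measurable_EFinP.
- apply: emeasurable_funM; apply/measurable_EFinP; first exact: mk.
  exact: measurable_box.
move=> [[z1 z2] z3] _; rewrite -!EFinM lee_fin.
have rhs0 : 0 <= bridge K b t s (z1, z2, z3)
    * box K b j (z1, z2, z3) by rewrite mulr_ge0 ?box_ge0// kk0.
rewrite {1}/cube /= !indicE.
have [c1|_] := boolP (z1 \in _); last by rewrite !mul0r mulr0.
have [c2|_] := boolP (z2 \in _); last by rewrite mulr0 mul0r mulr0.
have [c3|_] := boolP (z3 \in _); last by rewrite !mulr0.
have close a u : u \in cross_seg a j -> (u - a) ^+ 2 <= 4^-1 ^+ j.
  rewrite inE /cross_seg /= in_itv/= => /andP[l1 l2].
  rewrite qE -[leLHS]real_normK ?num_real// lerXn2r ?nnegrE ?normr_ge0 ?(ltW r0)//.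
  by rewrite ler_norml; apply/andP; split; lra.
have -> : box K b j (z1, z2, z3) = 1.
  rewrite /box /= !indicE c2 c3 mem_set ?mulr1//.
  move: c1; rewrite inE /cross_seg /axis_seg /= !in_itv/= => /andP[l1 l2].
  have m1 : 5 / 4 * 4 ^+ (K - j) <= s * 4 ^+ K.
    by rewrite -NE mulrA ler_wpM2r// exprn_ge0.
  have m2 : s * 4 ^+ K <= 7 / 4 * 4 ^+ (K - j).
    by rewrite -NE mulrA ler_wpM2r// exprn_ge0.
  by apply/andP; split; lra.
rewrite !mulr1; apply: bridge_ge => //; try exact: close.
by rewrite -[z3]subr0; exact: close.
Qed.

(** The preceding bound is integrated over a time window of length [4^-j / 2], which lies in []0,
    t[] because [7/4 * 4^-j < t]. *)
Lemma double_box_ge K b j t : (1 < j)%N -> (j <= K)%N -> 4 * 4^-1 ^+ j <= t ->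
  ((4 * bridge_const * 4^-1 ^+ j)%:E <=
   double_int (Ioo0 t) (bridge K b t)
     (fun z => (box K b j z)%:E))%E.
Proof.
move=> j2 jK qt; have k0 := bridge_const_gt0.
have q0 : 0 < 4^-1 ^+ j :> R by rewrite exprn_gt0.
pose T : set R := `[5 / 4 * 4^-1 ^+ j, 7 / 4 * 4^-1 ^+ j]%classic.
have mT : measurable T by exact: measurable_itv.
have kk := bridge_kernel t (bridge_start b) (bridge_end K b t).
have mi := @measurable_inner_int R _ (fun z => (box K b j z)%:E) kk.
have {}mi : measurable_fun setT (fun s => \int[@leb3 R]_z
    ((bridge K b t s z)%:E * (box K b j z)%:E))%E.
  apply: mi; last by move=> z; rewrite lee_fin box_ge0.
  by apply/measurable_EFinP; exact: measurable_box.
have i0 s : (0 <= \int[@leb3 R]_z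
    ((bridge K b t s z)%:E * (box K b j z)%:E))%E.
  apply: integral_ge0 => z _; apply: mule_ge0; rewrite lee_fin ?box_ge0//.
  by case: kk => _; apply.
apply: (@le_trans _ _
  (\int[@lebesgue_measure R]_(s in T) (cst (8 * bridge_const)%:E s))%E).
  rewrite integral_cst//= lebesgue_measure_itv/= lte_fin ifT; last lra.
  by rewrite -EFinD -EFinM lee_fin; lra.
apply: (@le_trans _ _ (\int[@lebesgue_measure R]_(s in T) \int[@leb3 R]_z
    ((bridge K b t s z)%:E * (box K b j z)%:E))%E).
  apply: ge0_le_integral => //.
  - by move=> s _; rewrite lee_fin mulr_ge0// ltW.
  - exact: measurable_funTS.
  - by move=> s; rewrite /T /= in_itv/= => /andP[l1 l2]; exact: inner_bridge_ge.
apply: ge0_subset_integral => //.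
- exact: measurable_itv.
- exact: measurable_funTS.
- by move=> s; rewrite /T /Ioo0 /= !in_itv/= => /andP[l1 l2]; apply/andP; split; lra.
Qed.

Lemma tube_bridge_ge e p K b t : (1 < p)%N -> 0 <= e -> 4 * 4^-1 ^+ p <= t ->
  ((4 * bridge_const * (e * \sum_(p <= j < K.+1) j%:R^-1))%:E <=
   double_int (Ioo0 t) (bridge K b t)
     (fun z => (tube e p K b z)%:E))%E.
Proof.
move=> p1 e0 qt; have kk := bridge_kernel t (bridge_start b) (bridge_end K b t).
rewrite double_int_tube//; last exact: measurable_itv.
rewrite mulrA mulr_sumr -sumEFin big_nat_cond [leRHS]big_nat_cond.
apply: lee_sum => j /andP[/andP[pj jK] _].
apply: (@le_trans _ _ ((height e j)%:E * (4 * bridge_const * 4^-1 ^+ j)%:E)%E).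
  rewrite -EFinM lee_fin /height.
  have four : 4 ^+ j * 4^-1 ^+ j = 1 :> R by rewrite -exprMn divff// expr1n.
  have -> : e * 4 ^+ j / j%:R * (4 * bridge_const * 4^-1 ^+ j) =
    4 * bridge_const * e / j%:R * (4 ^+ j * 4^-1 ^+ j) by ring.
  by rewrite four mulr1.
apply: lee_wpmul2l; first by rewrite lee_fin height_ge0.
apply: double_box_ge => //; first exact: leq_trans pj.
rewrite (le_trans _ qt)// ler_wpM2l// ler_wiXn2l// invf_le1 ?ler1n//.
Qed.

End tubes.

(** * The potential *)

Section potential.
Context {R : realType}.
Implicit Types (s t a e : R) (x y z : pt3 R) (j n m : nat).

(** * Assembly of the tubes *)

Lemma harmonic_block (p : nat) (M : R) :
  exists K, M <= \sum_(p.+1 <= j < K.+1) j%:R^-1.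
Proof.
have /cvgryPge : series (@harmonic R) @ \oo --> +oo%R.
  apply: nondecreasing_dvgn_lt; last exact: dvg_harmonic.
  by apply/nondecreasing_series => i _ _; exact: harmonic_ge0.
(* The term of index [i] of [harmonic] is [1/(i + 1)], so [series harmonic p] sums [1/j] for
   [1 <= j <= p], and subtracting it leaves the block that starts at [p + 1]. *)
move=> /(_ (M + series harmonic p))[k _ /(_ (k + p)%N (leq_addr _ _))].
rewrite /series/= => Mk; exists (k + p)%N; rewrite big_add1/=.
rewrite -lerBrDr in Mk; apply: (le_trans Mk).
by rewrite (big_cat_nat _ (n := p))//= ?leq_addl// addrAC subrr add0r.
Qed.

(** The target [n 2^n] compensates the factor [2^-n] of the tube of index [n]. *)
Definition block_end n : nat :=
  projT1 (cid (harmonic_block n.+1 (n%:R * 2 ^+ n))).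

Lemma block_endP n :
  n%:R <= 2^-1 ^+ n * \sum_(n.+2 <= j < (block_end n).+1) j%:R^-1 :> R.
Proof.
rewrite /block_end; case: cid => K /= nK.
rewrite mulrC exprVn ler_pdivlMr ?exprn_gt0//.
Qed.

(** The start [n.+2] lets bridges of any given duration reach all boxes once [n] is large; placing
    the axis at height [n] makes the series of tubes locally finite. *)
Definition nth_tube n z : R := tube (2^-1 ^+ n) n.+2 (block_end n) n%:R z.

Lemma nth_tube_ge0 n z : 0 <= nth_tube n z.
Proof. by rewrite tube_ge0// exprn_ge0. Qed.

Lemma measurable_nth_tube n : measurable_fun [set: pt3 R] (nth_tube n).
Proof. exact: measurable_tube. Qed.

Lemma nth_tube_eq0 n z : z.1.2 + 1 <= n%:R -> nth_tube n z = 0.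
Proof.
move=> zn; rewrite /nth_tube /tube big_nat_cond big1// => j /andP[/andP[nj _] _].
rewrite /box [\1_(cross_seg n%:R j) _]indicE memNset ?mulr0 ?mul0r ?mulr0//.
rewrite /cross_seg /= in_itv/= => /andP[l1 _].
have : 2^-1 ^+ j <= 2^-1 ^+ 1 :> R.
  by rewrite ler_wiXn2l ?invf_le1 ?ler1n// (leq_trans _ nj).
rewrite expr1; lra.
Qed.

Definition total z : \bar R := (\sum_(n <oo) (nth_tube n z)%:E)%E.

Lemma total_ge0 z : (0 <= total z)%E.
Proof. by apply: nneseries_ge0 => n _ _; rewrite lee_fin nth_tube_ge0. Qed.

(** At a given point all tubes with axis at least 1 above it vanish, so the series is a finite sum
    there. *)
Lemma total_fin_num z : total z \is a fin_num.
Proof.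
have [m zm] : exists m, z.1.2 + 1 <= m%:R.
  exists (Num.bound `|z.1.2 + 1|).
  exact: le_trans (ler_norm _) (ltW (archi_boundP (normr_ge0 _))).
rewrite /total (nneseries_split 0 m); last first.
  by move=> k _; rewrite lee_fin nth_tube_ge0.
rewrite add0n eseries0 ?adde0; last first.
  move=> k mk _; rewrite nth_tube_eq0// (le_trans zm)// ler_nat//.
by rewrite sumEFin.
Qed.

Lemma measurable_total : measurable_fun [set: pt3 R] total.
Proof.
apply: ge0_emeasurable_sum => [n z _ _|n _]; first by rewrite lee_fin nth_tube_ge0.
by apply/measurable_EFinP; exact: measurable_nth_tube.
Qed.

Definition potential z : R := - fine (total z).

Lemma potential_abs z : (`|potential z|%:E = total z)%E.
Proof.
by rewrite /potential normrN ger0_norm ?fine_ge0 ?total_ge0// fineK ?total_fin_num.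
Qed.

Lemma measurable_potential : measurable_fun [set: pt3 R] potential.
Proof.
apply: measurableT_comp => //; apply: measurableT_comp => //.
exact: measurable_total.
Qed.

Lemma potential_le0 z : potential z <= 0.
Proof. by rewrite oppr_le0 fine_ge0// total_ge0. Qed.

Lemma Ioo0_measurable t : measurable (Ioo0 t).
Proof. exact: measurable_itv. Qed.

Lemma double_int_potential t (k : R -> pt3 R -> R) : is_kernel k ->
  (\int[@lebesgue_measure R]_(s in Ioo0 t)
     \int[@leb3 R]_z (k s z * `|potential z|)%:E =
   \sum_(n <oo) double_int (Ioo0 t) k (fun z => (nth_tube n z)%:E))%E.
Proof.
move=> kk; rewrite -double_int_nneseries//.
- apply: eq_integral => s _; apply: eq_integral => z _.
  by rewrite EFinM potential_abs.
- exact: Ioo0_measurable.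
- by move=> n; apply/measurable_EFinP; exact: measurable_nth_tube.
- by move=> n z; rewrite lee_fin nth_tube_ge0.
Qed.

Lemma double_int_ge0 (D : set R) (k : R -> pt3 R -> R) (f : pt3 R -> R) :
  is_kernel k -> (forall z, 0 <= f z) ->
  (0 <= double_int D k (fun z => (f z)%:E))%E.
Proof.
move=> [_ k0] f0; apply: integral_ge0 => s _; apply: integral_ge0 => z _.
by rewrite -EFinM lee_fin mulr_ge0.
Qed.

(** * Kato condition for the potential *)

Lemma nth_tube_kato n x t : t <= 1 ->
  (double_int (Ioo0 t) (fun s z => g3 s x z) (fun z => (nth_tube n z)%:E)
    <= (800 * 2^-1 ^+ n)%:E)%E.
Proof.
move=> t1; have kk := g3_kernel x.
have e0 : 0 <= 2^-1 ^+ n :> R by rewrite exprn_ge0.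
apply: (le_trans _ (tube_kato_unit (block_end n) n%:R x (ltn0Sn n.+1) e0)).
apply: ge0_subset_integral => //.
- exact: Ioo0_measurable.
- apply: measurable_funTS; apply: measurable_inner_int => //.
    by apply/measurable_EFinP; exact: measurable_tube.
  by move=> z; rewrite lee_fin nth_tube_ge0.
- move=> s _; apply: integral_ge0 => z _.
  by rewrite -EFinM lee_fin mulr_ge0 ?g3_ge0 ?nth_tube_ge0.
- move=> s; rewrite /Ioo0 /= !in_itv/= => /andP[-> st].
  exact: lt_le_trans t1.
Qed.

Lemma exists_small_geometric e : 0 < e -> exists m, 2^-1 ^+ m <= e :> R.
Proof.
move=> e0; have ei0 : 0 <= e^-1 by rewrite invr_ge0 ltW.
exists (Num.bound e^-1); rewrite exprVn -[leRHS]invrK.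
rewrite lef_pV2 ?posrE ?invr_gt0 ?exprn_gt0//.
apply: (le_trans (ltW (archi_boundP ei0))).
by rewrite -natrX ler_nat ltnW// ltn_expl.
Qed.

Lemma geometric_tail m k : \sum_(m <= n < k) (2^-1 ^+ n : R) <= 2 * 2^-1 ^+ m.
Proof.
have [mk|km] := leqP m k; last first.
  by rewrite big_geq ?mulr_ge0 ?exprn_ge0// ltnW.
rewrite (eq_bigr (fun n => - (2 * 2^-1 ^+ n.+1 - 2 * 2^-1 ^+ n))); last first.
  by move=> n _; rewrite exprS; field.
rewrite sumrN (telescope_sumr (fun n => 2 * 2^-1 ^+ n))// opprB.
by rewrite gerBl mulr_ge0// exprn_ge0.
Qed.

Definition head_sup m : R :=
  \sum_(0 <= n < m) tube_sup (2^-1 ^+ n) n.+2 (block_end n).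

Lemma head_sup_ge0 m : 0 <= head_sup m.
Proof.
apply: sumr_ge0 => n _; apply: sumr_ge0 => j _.
by rewrite height_ge0// exprn_ge0.
Qed.

(** The first [m] tubes are bounded and contribute a multiple of [t]; each later one contributes at
    most [800 * 2^-n], a geometric tail uniform in [t] and in the starting point. *)
Lemma katoSup_potential_le m t : 0 < t -> t <= 1 ->
  (katoSup potential t <= (head_sup m * t + 1600 * 2^-1 ^+ m)%:E)%E.
Proof.
move=> t0 t1; apply: ge_ereal_sup => _ [x _ <-].
have kk := g3_kernel x.
rewrite (double_int_potential t kk) (nneseries_split 0 m); last first.
  by move=> n _; apply: double_int_ge0 => // z; exact: nth_tube_ge0.
rewrite add0n EFinD; apply: leeD.
  rewrite mulr_suml -sumEFin; apply: lee_sum => n _.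
  apply: bounded_kato => //.
  - exact: measurable_nth_tube.
  - exact: nth_tube_ge0.
  - by move=> z; apply: tube_le_sup; rewrite exprn_ge0.
apply: lime_le.
  apply: is_cvg_nneseries => n _ _; apply: double_int_ge0 => // z.
  exact: nth_tube_ge0.
apply: nearW => k /=.
apply: (@le_trans _ _ (\sum_(m <= n < k) (800 * 2^-1 ^+ n)%:E)%E).
  by apply: lee_sum => n _; exact: nth_tube_kato.
rewrite sumEFin lee_fin -mulr_sumr.
have := geometric_tail m k; lra.
Qed.

Lemma katoSup_ge0 (V : pt3 R -> R) t : (0 <= katoSup V t)%E.
Proof.
apply: (@le_trans _ _ (\int[@lebesgue_measure R]_(s in Ioo0 t)
  \int[@leb3 R]_z (g3 s ((0%R, 0%R), 0%R) z * `|V z|)%:E)%E).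
  apply: integral_ge0 => s _; apply: integral_ge0 => z _.
  by rewrite lee_fin mulr_ge0 ?g3_ge0.
by apply: ereal_sup_ubound; exists ((0, 0), 0).
Qed.

Lemma potential_kato : Kato3 potential.
Proof.
(* Convergence in the extended reals requires finiteness near 0, for which the bound with [m = 0]
   suffices. *)
apply/fine_cvgP; split.
  near=> t.
  have t0 : 0 < t by near: t; exact: nbhs_right_gt.
  have t1 : t <= 1 by near: t; exact: nbhs_right_le.
  rewrite ge0_fin_numE ?katoSup_ge0//.
  by rewrite (le_lt_trans (katoSup_potential_le 0 t0 t1))// ltry.
apply/cvgrPdist_le => e e0.
have [m me] : exists m, 1600 * 2^-1 ^+ m <= e / 2.
  have [|m me] := @exists_small_geometric (e / 3200); first by lra.
  by exists m; lra.
near=> t.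
have t0 : 0 < t by near: t; exact: nbhs_right_gt.
have t1 : t <= 1 by near: t; exact: nbhs_right_le.
(* [m] is fixed first, so the head is a constant here; adding 1 keeps the divisor positive. *)
have te : t <= e / 2 / (head_sup m + 1).
  near: t; apply: nbhs_right_le; rewrite !divr_gt0//.
  by rewrite ltr_wpDl ?head_sup_ge0.
have kt := katoSup_potential_le m t0 t1.
have kf : katoSup potential t \is a fin_num.
  by rewrite ge0_fin_numE ?katoSup_ge0// (le_lt_trans kt)// ltry.
rewrite sub0r normrN ger0_norm ?fine_ge0 ?katoSup_ge0//.
rewrite -lee_fin fineK//; apply: (le_trans kt); rewrite lee_fin.
have h0 := head_sup_ge0 m.
move: te; rewrite ler_pdivlMr; last by rewrite ltr_wpDl.
rewrite mulrDr mulr1 [t * _]mulrC; lra.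
Unshelve. all: by end_near.
Qed.

(** For each level [A], one tube and a bridge along its axis suffice; both are chosen depending on
    [A] and [t]. *)
Lemma Snorm_potential t : 0 < t -> Snorm potential t = +oo%E.
Proof.
move=> t0; apply/eqyP => A A0.
have k0 := @bridge_const_gt0 R.
have [n nA nt] : exists2 n, A <= 4 * bridge_const * n%:R & 4 * 4^-1 ^+ n.+2 <= t.
  have [n2 n2t] := exists_small_geometric t0.
  have k4 : 0 < 4 * bridge_const :> R by rewrite mulr_gt0.
  have A1 : 0 <= A / (4 * bridge_const) by rewrite divr_ge0 ?ltW.
  (* The first argument makes the gain reach [A]; the second gives
     [4 * 4^-(n+2) <= 4^-n <= 2^-n <= t]. *)
  exists (maxn (Num.bound (A / (4 * bridge_const))) n2).
    rewrite -ler_pdivrMl// mulrC (le_trans (ltW (archi_boundP A1)))//.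
    by rewrite ler_nat leq_maxl.
  set n := maxn _ _; apply: le_trans n2t.
  apply: (@le_trans _ _ (2^-1 ^+ n)); last first.
    by rewrite ler_wiXn2l ?leq_maxr// invf_le1 ?ler1n.
  rewrite !exprS; apply: (@le_trans _ _ (4^-1 ^+ n)).
    have : 0 <= 4^-1 ^+ n :> R by rewrite exprn_ge0.
    lra.
  by rewrite lerXn2r ?nnegrE//; lra.
have kk := bridge_kernel t (bridge_start n%:R) (bridge_end (block_end n) n%:R t).
apply: (@le_trans _ _ (Sfun potential t (bridge_start n%:R)
    (bridge_end (block_end n) n%:R t))); last first.
  apply: ereal_sup_ubound; exists (bridge_start n%:R) => //.
  by exists (bridge_end (block_end n) n%:R t).
rewrite /Sfun (double_int_potential t kk).
(* All terms are nonnegative, so only the tube of index [n] is kept from the series. *)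
apply: (@le_trans _ _ (double_int (Ioo0 t) (bridge (block_end n) n%:R t)
    (fun z => (nth_tube n z)%:E))); last first.
  have d0 i : (0 <= double_int (Ioo0 t) (bridge (block_end n) n%:R t)
      (fun z => (nth_tube i z)%:E))%E.
    by apply: double_int_ge0 => // z; exact: nth_tube_ge0.
  rewrite (@nneseriesD1 _ _ n xpredT)// leeDl//.
  by apply: nneseries_ge0 => i _ _; exact: d0.
have e0 : 0 <= 2^-1 ^+ n :> R by rewrite exprn_ge0.
apply: (le_trans _ (@tube_bridge_ge _ _ n.+2 (block_end n) n%:R t isT e0 nt)).
rewrite lee_fin; apply: (le_trans nA).
by rewrite ler_wpM2l ?block_endP// mulr_ge0// ltW.
Qed.

End potential.

Theorem theorem1p5 (R : realType) :
  exists V : pt3 R -> R,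
    measurable_fun [set: pt3 R] V /\ (forall z, V z <= 0) /\
    Kato3 V /\ (forall t : R, 0 < t -> Snorm V t = +oo%E).
Proof.
exists potential; split; first exact: measurable_potential.
split; first exact: potential_le0.
by split; [exact: potential_kato|exact: Snorm_potential].
Qed.
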